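(* Let $g=2k-1$ with $k\ge 2$. The number of $\mathfrak{S}_{2g+2}$-orbits of spin structures of $\Sigma_g$ is $k+1$. The orbits are $\mathcal{C}_0,\mathcal{C}_1,\dots,\mathcal{C}_k$, and a representative of the orbit $\mathcal{C}_m$ is given by the spin structure whose corresponding matrix is $M_m$, where $M_0$ is the $2\times g$ zero matrix, $M_m=\begin{pmatrix}A_m & 0\end{pmatrix}$ for $1\le m\le k-1$ (all columns after the block $A_m$ being zero), and $M_k=A_k$.
   Context: $\Sigma_g$ is a compact connected oriented surface of genus $g$, and $\alpha_1,\dots,\alpha_g,\beta_1,\dots,\beta_g$ is a symplectic basis of $H_1(\Sigma_g,\mathbb{Z}/2)$, i.e. $\alpha_i\cdot\beta_j=\delta_{ij}$, $\alpha_i\cdot\alpha_j=\beta_i\cdot\beta_j=0$ for the mod 2 intersection number. A spin structure is a map $c:H_1(\Sigma_g,\mathbb{Z}/2)\to\mathbb{Z}/2$ with $c(x+y)=c(x)+c(y)+x\cdot y$ for all $x,y$; $\mathcal{C}$ is the set of spin structures. The corresponding matrix of $c$ is the $2\times g$ matrix $M$ over $\mathbb{Z}/2$ whose $i$-th column is $\begin{pmatrix}c(\alpha_i)\\c(\beta_i)\end{pmatrix}$; it determines $c$, and every $2\times g$ matrix over $\mathbb{Z}/2$ arises. For $\gamma\in H_1(\Sigma_g,\mathbb{Z}/2)$ let $T_\gamma(x)=x+(x\cdot\gamma)\gamma$, an element of the group $Sp_{2g}(\mathbb{Z}/2)$ of automorphisms preserving the intersection number. Let $\sigma_i=(i,i+1)\in\mathfrak{S}_{2g+2}$,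 $1\le i\le 2g+1$, where $\mathfrak{S}_n$ is the symmetric group. The group $\mathfrak{S}_{2g+2}$ acts through the homomorphism $\iota:\mathfrak{S}_{2g+2}\to Sp_{2g}(\mathbb{Z}/2)$ determined by $\iota(\sigma_1)=T_{\beta_1}$, $\iota(\sigma_{2g+1})=T_{\beta_g}$, $\iota(\sigma_{2i})=T_{\alpha_i}$ ($1\le i\le g$), $\iota(\sigma_{2j+1})=T_{\beta_j+\beta_{j+1}}$ ($1\le j\le g-1$). It acts on $\mathcal{C}$ from the right by $c\circ\sigma:=c\circ\iota(\sigma)$. For $i\ge1$, $A_i$ is the $2\times(2i-1)$ matrix over $\mathbb{Z}/2$ whose odd-numbered columns are $\begin{pmatrix}1\\1\end{pmatrix}$ and whose even-numbered columns are $\begin{pmatrix}1\\0\end{pmatrix}$. *)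

(* Defs.v *)
From HB Require Import structures.
From mathcomp Require Import all_boot all_order all_fingroup all_algebra.
From mathcomp Require Import all_solvable all_field.

Set Implicit Arguments.
Unset Strict Implicit.
Unset Printing Implicit Defensive.

Import GRing.Theory.
Local Open Scope ring_scope.

(* The first homology H_1(Sigma_g, Z/2) enters through the structure it        *)
(* carries: an F_2-vector space V, an alternating bilinear form (the mod 2     *)
(* intersection number) and a symplectic basis of V. finvect_type V is V       *)
(* itself, with the finType structure coming from the finiteness of F_2.       *)

Section Symplectic.

Variables (V : vectType 'F_2) (dot : {biscalar finvect_type V}).
Local Notation H := (finvect_type V).

(* beta`_j . alpha`_i is fixed too: an alternating form over F_2 is symmetric. *)
Record symplectic_basis (g : nat) (alpha beta : g.-tuple H) : Prop := {
  dot_alternating : forall x, dot x x = 0;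
  sympl_basis : basis_of {:H} (alpha ++ beta);
  dot_alpha_beta : forall i j : 'I_g, dot alpha`_i beta`_j = (i == j)%:R;
  dot_alpha_alpha : forall i j : 'I_g, dot alpha`_i alpha`_j = 0;
  dot_beta_beta : forall i j : 'I_g, dot beta`_i beta`_j = 0
}.

Definition spin_structures : {set {ffun H -> 'F_2}} :=
  [set c : {ffun H -> 'F_2} |
    [forall x, forall y, c (x + y) == c x + c y + dot x y]].

Definition spin_mx (g : nat) (alpha beta : g.-tuple H)
    (c : {ffun H -> 'F_2}) : 'M['F_2]_(2, g) :=
  \matrix_(r < 2, i < g) (if r == 0 then c alpha`_i else c beta`_i).

(* Over F_2 an additive map is linear. *)
Definition Sp : {set {perm H}} :=
  [set s : {perm H} | [forall x, forall y,
    (s (x + y) == s x + s y) && (dot (s x) (s y) == dot x y)]].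

Lemma Sp_group_set : group_set Sp.
Proof.
apply/group_setP; split=> [|s t].
  by rewrite inE; apply/'forall_forallP=> x y; rewrite !perm1 !eqxx.
rewrite !inE => /'forall_forallP sP /'forall_forallP tP.
apply/'forall_forallP=> x y; rewrite !permM.
have /andP[/eqP-> /eqP<-] := sP x y.
by have /andP[-> ->] := tP (s x) (s y).
Qed.
Canonical Sp_group := Group Sp_group_set.

Definition transvection (gamma x : H) : H := x + dot x gamma *: gamma.

(* sigma_i = (i, i+1) for 1 <= i <= 2g+1; the letters 1, ..., 2g+2 are the     *)
(* elements 0, ..., 2g+1 of 'I_(2g+2).                                         *)
Definition sigma (g i : nat) : 'S_((2 * g).+2)%N := tperm (inord i.-1) (inord i).

(* i and j range as in alpha_1, ..., alpha_g, hence the shift in the indices   *)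
(* of the 0-based sequences alpha and beta. Products of permutations are       *)
(* reversed compositions both in the source and in the target of iota, so      *)
(* iota is a homomorphism for the composition of maps on both sides.           *)
Record is_iota (g : nat) (alpha beta : g.-tuple H)
    (iota : {morphism [set: 'S_((2 * g).+2)%N] >-> {perm H}}) : Prop := {
  iota_Sp : (iota @* [set: 'S_((2 * g).+2)%N] \subset Sp)%g;
  iota_first : iota (sigma g 1) =1 transvection beta`_0;
  iota_last : iota (sigma g (2 * g).+1%N) =1 transvection beta`_(g.-1);
  iota_even : forall i, (1 <= i <= g)%N ->
    iota (sigma g (2 * i)%N) =1 transvection alpha`_(i.-1);
  iota_odd : forall j, (1 <= j <= g.-1)%N ->
    iota (sigma g (2 * j).+1%N) =1 transvection (beta`_(j.-1) + beta`_j)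
}.

Section Orbits.

Variables (n : nat) (iota : {morphism [set: 'S_n] >-> {perm H}}).

Definition spin_act (c : {ffun H -> 'F_2}) (s : 'S_n) : {ffun H -> 'F_2} :=
  [ffun x => c (iota s x)].

Definition spin_orbit (c : {ffun H -> 'F_2}) : {set {ffun H -> 'F_2}} :=
  [set spin_act c s | s : 'S_n].

Definition spin_orbits : {set {set {ffun H -> 'F_2}}} :=
  [set spin_orbit c | c in spin_structures].

End Orbits.

End Symplectic.

(* The i-th column, counted from 1, is the one of index i - 1. *)
Definition A_mx (i : nat) : 'M['F_2]_(2, (2 * i).-1%N) :=
  \matrix_(r < 2, j < (2 * i).-1%N) (if r == 0 then 1 else (odd j.+1)%:R).

(* For m = 0 the block A_mx 0 has no column. conform_mx only transports the    *)
(* width (2m-1) + (g-(2m-1)) to g, which are equal when 2m-1 <= g.             *)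
Definition M_mx (g m : nat) : 'M['F_2]_(2, g) :=
  conform_mx 0 (row_mx (A_mx m) (0 : 'M['F_2]_(2, (g - (2 * m).-1)%N))).

Lemma M_mxE g m (r : 'I_2) (j : 'I_g) : ((2 * m).-1 <= g)%N ->
  M_mx g m r j =
    if (j < (2 * m).-1)%N then (if r == 0 then 1 else (odd j.+1)%:R) else 0.
Proof.
move=> le_mg.
have conformE p q (e : p = q) (Z : 'M['F_2]_(2, q)) (B : 'M['F_2]_(2, p)) :
    conform_mx Z B = castmx (erefl 2%N, e) B.
  by case: _ / e Z => Z; rewrite conform_mx_id castmx_id.
rewrite /M_mx (conformE _ _ (subnKC le_mg)) castmxE /= cast_ord_id mxE.
case: splitP => l /= eq_l; first by rewrite mxE eq_l ltn_ord.
by rewrite mxE eq_l ltnNge leq_addr.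
Qed.

(* Main.v *)
Require Import Defs.
From mathcomp Require Import all_boot all_order all_fingroup all_algebra.
From mathcomp Require Import all_solvable all_field.
From mathcomp Require Import ring zify.

Import GRing.Theory.
Local Open Scope ring_scope.

(* Let gamma_1, ..., gamma_(2g+1) be the vectors of the transvections by which *)
(* the adjacent transpositions act. A subset S of the 2g+2 letters defines a   *)
(* spin structure c by c(gamma_i) = 1 if S contains both or none of i, i + 1,  *)
(* and c(gamma_i) = 0 otherwise, provided that |S| = g + 1 mod 2. Every spin   *)
(* structure arises in this way, from exactly one pair of complementary        *)
(* subsets, and compatibly with the actions of the symmetric group. For        *)
(* g = 2k - 1 an orbit is thus an even cardinality |S| up to |S| <-> 4k - |S|, *)
(* and M_m corresponds to the class of 2(k - m).                               *)

(** The vectors gamma_i form a chain: two of them meet exactly when their transpositions share a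
    single letter ([dot_gamma]). They span the homology, so a spin structure is a labelling of the
    edges of a path on the 2g+2 letters, and S is one side of the resulting two-colouring of the
    letters. The one linear relation among the gamma_i gives the parity of |S| ([colors_odd_card]).
    The transvection along gamma_i fixes c if c(gamma_i) = 1; otherwise, among the chain vectors, it
    changes c exactly at the neighbours of gamma_i. This is the effect of exchanging i and i + 1 in
    S ([colors_sigma]). Permutations are transitive on subsets of a given size, so |S| up to
    complement classifies the orbits ([eq_card_spin_orbit], [card_colors_orbit]). The sizes 0, 2,
    ..., 2k represent the k + 1 classes. *)

Lemma addrr_F2 (x : 'F_2) : x + x = 0.
Proof. by apply: addrr_pchar2; apply: pchar_Fp. Qed.

Lemma F2_eq_nat (x : 'F_2) : x = (x == 1)%:R.
Proof. by case: x => -[|[|]] // ?; apply/eqP. Qed.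

Lemma natr_F2 (n : nat) : n%:R = (odd n)%:R :> 'F_2.
Proof. by apply/val_inj; rewrite /= !val_Fp_nat // !modn2; case: odd. Qed.

(** The indicator sequences of S and T are rearrangements of each other. *)
Lemma exists_perm_preimset n (S T : {set 'I_n}) :
  #|S| = #|T| -> exists s : 'S_n, S = s @^-1: T.
Proof.
move=> eqST.
have sum_count (A : {set 'I_n}) :
    count_mem true [tuple i \in A | i < n] = #|A|.
  rewrite count_map -sum1_count -sum1_card /= big_enum_cond /=.
  by apply: eq_bigl => i; rewrite eqb_id.
have /tuple_permP[s eq_s] :
    perm_eq [tuple i \in S | i < n] [tuple i \in T | i < n].
  have size_count (t : seq bool) :
      (count_mem true t + count_mem false t = size t)%N.
    rewrite -(count_predC (pred1 true) t); congr addn.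
    by apply: eq_count => -[].
  have countT : count_mem true [tuple i \in S | i < n] =
                count_mem true [tuple i \in T | i < n].
    by rewrite !sum_count.
  apply/allP => -[] _ /=; first by apply/eqP.
  rewrite -(eqn_add2l (count_mem true [tuple i \in S | i < n])).
  by rewrite {2}countT !size_count !size_tuple.
exists s; apply/setP => i; rewrite inE.
have /(congr1 (fun t => tnth t i)) := val_inj eq_s.
by rewrite !tnth_mktuple.
Qed.

(** Conjugating (0 i) by (i i+1) gives (0 i+1), and the transpositions moving 0 generate. *)
Lemma adjacent_tperm_gen n (G : {group 'S_n.+1}) :
  (forall i, (i < n)%N -> tperm (inord i) (inord i.+1) \in G) -> G :=: setT.
Proof.
move=> adjG; apply/eqP; rewrite -subTset -(gen_tperm (inord 0)) gen_subG.
have mem0 i : (i <= n)%N -> tperm (inord 0) (inord i) \in G.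
  elim: i => [|i IHi] le_in; first by rewrite tperm1 group1.
  have [->|i_gt0] := posnP i; first by apply: adjG; lia.
  have Gi := IHi (ltnW le_in).
  suff -> : tperm (inord 0) (inord i.+1) =
      (tperm (inord 0) (inord i) ^ tperm (inord i) (inord i.+1))%g :> 'S_n.+1.
    by rewrite groupJ // adjG.
  rewrite tpermJ tpermL tpermD //; apply/eqP => /(congr1 val).
    by rewrite /= !inordK; lia.
  by rewrite /= !inordK; lia.
apply/subsetP => _ /imsetP[y _ ->].
by rewrite -(inord_val y) mem0 // -ltnS.
Qed.

Lemma adjacent_tperm_ind n (P : 'S_n.+1 -> Prop) :
  P 1%g -> (forall s t, P s -> P t -> P (s * t)%g) ->
  (forall i, (i < n)%N -> P (tperm (inord i) (inord i.+1))) ->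
  forall s, P s.
Proof.
move=> P1 PM Padj s.
pose A := [set tperm (inord i) (inord i.+1) | i : 'I_n] : {set 'S_n.+1}.
have : s \in <<A>>%G.
  rewrite (@adjacent_tperm_gen n <<A>>) ?inE // => i lt_in.
  by apply/mem_gen/imsetP; exists (Ordinal lt_in).
case/gen_prodgP => m [f Af ->]; apply: (big_ind P) => // i _.
by have /imsetP[j _ ->] := Af i; apply: Padj.
Qed.

(** Mod 2, the truth value of a = b is 1 + a + b. *)
Lemma sum_eqb_F2 (f : nat -> bool) m :
  \sum_(j < m) (f (2 * j)%N == f (2 * j).+1)%:R =
    (m + \sum_(i < (2 * m)%N) f i)%:R :> 'F_2.
Proof.
elim: m => [|m IHm]; first by rewrite !big_ord0.
rewrite big_ord_recr IHm mulnS /= 2!big_ord_recr /= -natrD.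
rewrite [LHS]natr_F2 [RHS]natr_F2; congr (_%:R).
rewrite !(oddD, addSn, addnS, oddS, oddb) /=.
by do 2 case: odd; do 2 case: (f _).
Qed.

(** * Spin structures and their matrices *)

Section SpinStructures.

Set Implicit Arguments.
Unset Strict Implicit.

Context (V : vectType 'F_2) (dot : {biscalar finvect_type V}) (g : nat).
Context (alpha beta : g.-tuple (finvect_type V)).
Hypothesis sympl : symplectic_basis dot alpha beta.

Local Notation H := (finvect_type V).
Implicit Types (x y : H) (c : {ffun H -> 'F_2}).

Let n := (2 * g).+2.

Implicit Type S : {set 'I_n}.

Lemma dot_sym x y : dot x y = dot y x.
Proof.
have := dot_alternating sympl (x + y).
rewrite linearDl !linearDr !(dot_alternating sympl) add0r addr0 => /eqP.
by rewrite addr_eq0 => /eqP ->; apply/eqP; rewrite eq_sym -addr_eq0 addrr_F2.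
Qed.

Lemma sympl_ind (P : H -> Prop) :
  P 0 -> (forall x y, P x -> P y -> P (x + y)) ->
  (forall i : 'I_g, P alpha`_i) -> (forall i : 'I_g, P beta`_i) ->
  forall x, P x.
Proof.
move=> P0 PD Pa Pb x; rewrite (coord_basis (sympl_basis sympl) (memvf x)).
apply: (big_ind P) => // i _; rewrite (F2_eq_nat (coord _ _ _)).
case: eqP => _; last by rewrite scale0r.
rewrite scale1r nth_cat size_tuple; case: ltnP => lt_ig.
  by apply: (Pa (Ordinal lt_ig)).
have lt_ig' : (i - g < g)%N by rewrite ltn_subLR.
by apply: (Pb (Ordinal lt_ig')).
Qed.

Lemma dot_beta_alpha (i j : 'I_g) : dot beta`_i alpha`_j = (i == j)%:R.
Proof. by rewrite dot_sym (dot_alpha_beta sympl) eq_sym. Qed.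

(** Both sides are additive in x, so basis vectors suffice. *)
Lemma dot_coordE x y :
  dot x y = \sum_(i < g) (dot x alpha`_i * dot y beta`_i +
                          dot x beta`_i * dot y alpha`_i).
Proof.
elim/sympl_ind: x => [|x x' IHx IHx'|j|j].
- by rewrite linear0l big1 // => i _; rewrite !linear0l !mul0r addr0.
- rewrite linearDl IHx IHx' -big_split; apply: eq_bigr => i _ /=.
  by rewrite !linearDl; ring.
- rewrite (bigD1 j) //= big1 => [|i neq_ij].
    rewrite (dot_alpha_beta sympl) (dot_alpha_alpha sympl) eqxx.
    by rewrite mul0r mul1r add0r addr0 dot_sym.
  rewrite (dot_alpha_beta sympl) (dot_alpha_alpha sympl) eq_sym.
  by rewrite (negPf neq_ij) !mul0r addr0.
- rewrite (bigD1 j) //= big1 => [|i neq_ij].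
    rewrite dot_beta_alpha (dot_beta_beta sympl) eqxx.
    by rewrite mul0r mul1r !addr0 dot_sym.
  rewrite dot_beta_alpha (dot_beta_beta sympl) eq_sym.
  by rewrite (negPf neq_ij) !mul0r addr0.
Qed.

Lemma spinP c :
  reflect (forall x y, c (x + y) = c x + c y + dot x y)
          (c \in spin_structures dot).
Proof.
rewrite inE; apply: (iffP 'forall_forallP) => [cP x y|cP x y]; last exact/eqP.
exact/eqP.
Qed.

Lemma spin0 c : c \in spin_structures dot -> c 0 = 0.
Proof.
move=> /spinP/(_ 0 0); rewrite linear0l !addr0 => /eqP.
by rewrite -subr_eq subrr => /eqP.
Qed.

Lemma spin_eq_basis c c' :
  c \in spin_structures dot -> c' \in spin_structures dot ->
  (forall i : 'I_g, c alpha`_i = c' alpha`_i) ->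
  (forall i : 'I_g, c beta`_i = c' beta`_i) -> c = c'.
Proof.
move=> cP c'P eqa eqb; apply/ffunP; elim/sympl_ind=> // [|x y eqx eqy].
  by rewrite !spin0.
by rewrite (spinP _ cP) (spinP _ c'P) eqx eqy.
Qed.

Lemma spin_mx_inj : {in spin_structures dot &, injective (spin_mx alpha beta)}.
Proof.
move=> c c' cP c'P /matrixP eq_mx; apply: spin_eq_basis => // i.
  by have := eq_mx 0 i; rewrite !mxE.
by have := eq_mx 1 i; rewrite !mxE.
Qed.

Lemma spin_mx_surj (M : 'M['F_2]_(2, g)) :
  exists2 c, c \in spin_structures dot & spin_mx alpha beta c = M.
Proof.
(* The products (x.alpha_i)(x.beta_i) sum to a spin structure vanishing on the basis; the remaining
   terms are additive and prescribe the values there. *)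
exists [ffun x : H => \sum_(i < g) (dot x alpha`_i * dot x beta`_i +
          (dot x beta`_i * M 0 i + dot x alpha`_i * M 1 i))].
  apply/spinP => x y; rewrite !ffunE dot_coordE -!big_split /=.
  by apply: eq_bigr => i _; rewrite !linearDl; ring.
apply/matrixP => r j; rewrite !mxE !ffunE.
have [->|] := eqVneq r 0.
  rewrite (bigD1 j) //= big1 => [|i neq_ij].
    rewrite (dot_alpha_beta sympl) (dot_alpha_alpha sympl) eqxx.
    by rewrite !mul0r mul1r !addr0 add0r.
  rewrite (dot_alpha_beta sympl) (dot_alpha_alpha sympl) eq_sym.
  by rewrite (negPf neq_ij) !mul0r !addr0.
case: r => -[|[|]] // lt_r _; have -> : Ordinal lt_r = 1 by exact: val_inj.
rewrite (bigD1 j) //= big1 => [|i neq_ij].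
  rewrite dot_beta_alpha (dot_beta_beta sympl) eqxx.
  by rewrite mulr0 mul0r mul1r !add0r addr0.
rewrite dot_beta_alpha (dot_beta_beta sympl) eq_sym.
by rewrite (negPf neq_ij) !mul0r !addr0.
Qed.

(** * The chain of vectors behind the adjacent transpositions *)

(* [beta_pad j] is the paper's beta_j, extended by beta_0 = beta_(g+1) = 0 so  *)
(* that beta_1 and beta_g become cases of beta_j + beta_(j+1).                 *)
Definition beta_pad (j : nat) : H := if j is j'.+1 then beta`_j' else 0.

(* The vector called gamma_(i+1) above.                                        *)
Definition gamma (i : nat) : H :=
  if odd i then alpha`_i./2 else beta_pad i./2 + beta_pad i./2.+1.

Lemma gamma_odd j : gamma (2 * j).+1 = alpha`_j.
Proof. by rewrite /gamma mul2n /= odd_double uphalf_double. Qed.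

Lemma gamma_even j : gamma (2 * j) = beta_pad j + beta_pad j.+1.
Proof. by rewrite /gamma mul2n odd_double doubleK. Qed.

Lemma dot_alpha_beta_pad (i : 'I_g) j : dot alpha`_i (beta_pad j) = (i.+1 == j)%:R.
Proof.
case: j => [|j] /=; first by rewrite linear0r.
have [lt_jg|le_gj] := ltnP j g.
  by rewrite (dot_alpha_beta sympl i (Ordinal lt_jg)).
rewrite [beta`_j]nth_default ?size_tuple // linear0r; case: eqP => // -[eq_ij].
by have := ltn_ord i; rewrite eq_ij ltnNge le_gj.
Qed.

Lemma dot_beta_pad i j : dot (beta_pad i) (beta_pad j) = 0.
Proof.
case: i j => [|i] [|j]; rewrite ?linear0l ?linear0r //=.
have [lt_ig|le_gi] := ltnP i g; last first.
  by rewrite [beta`_i]nth_default ?size_tuple // linear0l.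
have [lt_jg|le_gj] := ltnP j g; last first.
  by rewrite [beta`_j]nth_default ?size_tuple // linear0r.
exact: (dot_beta_beta sympl (Ordinal lt_ig) (Ordinal lt_jg)).
Qed.

Lemma dot_gamma i j : (i < n.-1)%N -> (j < n.-1)%N ->
  dot (gamma i) (gamma j) = ((i == j.+1) || (j == i.+1))%:R.
Proof.
have nat_split m : exists a, m = (2 * a)%N \/ m = (2 * a).+1.
  by exists m./2; rewrite mul2n; have := odd_double_half m; case: odd; lia.
rewrite /n => lt_i lt_j.
have [a [eqi|eqi]] := nat_split i; have [b [eqj|eqj]] := nat_split j;
  rewrite {}eqi {}eqj in lt_i lt_j *; rewrite ?gamma_odd ?gamma_even.
- rewrite linearDl !linearDr !dot_beta_pad !addr0.
  by have -> : (2 * a == (2 * b).+1)%N || (2 * b == (2 * a).+1)%N = false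
    by lia.
- have lt_b : (b < g)%N by lia.
  rewrite dot_sym linearDr !(dot_alpha_beta_pad (Ordinal lt_b)) /=.
  by rewrite -natrD; congr _%:R; lia.
- have lt_a : (a < g)%N by lia.
  rewrite linearDr !(dot_alpha_beta_pad (Ordinal lt_a)) /=.
  by rewrite -natrD; congr _%:R; lia.
- have lt_a : (a < g)%N by lia.
  have lt_b : (b < g)%N by lia.
  rewrite (dot_alpha_alpha sympl (Ordinal lt_a) (Ordinal lt_b)).
  by have -> : ((2 * a).+1 == (2 * b).+2)%N || ((2 * b).+1 == (2 * a).+2)%N
    = false by lia.
Qed.

Lemma spin_transvection c y x : c \in spin_structures dot ->
  c (transvection dot y x) = c x + dot x y * (c y + 1).
Proof.
move=> cP; rewrite /transvection (spinP _ cP) linearZr_LR /=.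
rewrite (F2_eq_nat (dot x y)); case: eqP => _; last first.
  by rewrite scale0r spin0 // !mul0r !addr0.
by rewrite scale1r !mul1r addrA.
Qed.

(** * Spin structures as two-colourings of the letters *)

(** Indices start at 0: [gamma i] is the edge joining the letters [i] and [i.+1], and its label says
    whether the two letters are on the same side. *)
Definition colors (S : {set 'I_n}) c := forall i, (i < n.-1)%N ->
  c (gamma i) = ((inord i \in S) == (inord i.+1 \in S))%:R.

Lemma spin_gamma_even c j : c \in spin_structures dot ->
  c (gamma (2 * j)) = c (beta_pad j) + c (beta_pad j.+1).
Proof. by move=> /spinP cP; rewrite gamma_even cP dot_beta_pad addr0. Qed.

(** The alpha_i are chain vectors, and the values on beta_1, beta_2, ... follow one by one from
    [beta_pad 0 = 0]. *)
Lemma colors_inj S c c' :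
  c \in spin_structures dot -> c' \in spin_structures dot ->
  colors S c -> colors S c' -> c = c'.
Proof.
move=> cP c'P Sc Sc'.
have eqcc' i : (i < n.-1)%N -> c (gamma i) = c' (gamma i).
  by move=> lt_i; rewrite Sc // Sc'.
have eqb j : (j <= g)%N -> c (beta_pad j) = c' (beta_pad j).
  elim: j => [|j IHj] lt_jg; first by rewrite !spin0.
  have := eqcc' (2 * j)%N; rewrite !spin_gamma_even // IHj; last exact: ltnW.
  by move=> eqj; apply: (addrI (c' (beta_pad j))); apply: eqj; rewrite /n; lia.
apply: spin_eq_basis => // i.
  by rewrite -gamma_odd eqcc' // /n; have := ltn_ord i; lia.
exact: (eqb i.+1 (ltn_ord i)).
Qed.

Lemma colors_exist c : exists S, colors S c.
Proof.
(* Colour along the path: letter 0 is outside S, and each edge label then forces the next letter. *)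
pose f := fix f i := if i is j.+1 then f j == (c (gamma j) == 1) else false.
exists [set i : 'I_n | f i] => i lt_i; rewrite !inE !inordK; last 2 first.
- by rewrite /n in lt_i *; lia.
- by rewrite /n in lt_i *; lia.
by rewrite /= [LHS]F2_eq_nat; case: (f i); case: (_ == 1).
Qed.

Lemma colors_setC S c : colors S c -> colors (~: S) c.
Proof. by move=> Sc i lt_i; rewrite Sc // !inE; do 2 case: (_ \in S). Qed.

(** Equal edge labels mean that S and T agree at all letters or at none. *)
Lemma colors_unique S T c : colors S c -> colors T c -> T = S \/ T = ~: S.
Proof.
move=> Sc Tc.
have agree i : (i < n)%N ->
    ((inord i \in T) == (inord i \in S)) = ((inord 0 \in T) == (inord 0 \in S)).
  elim: i => // i IHi lt_i; rewrite -IHi; last exact: ltnW.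
  have := Sc i lt_i; rewrite (Tc i lt_i).
  by do 2 case: (_ \in T); do 2 case: (_ \in S).
have agreeE (i : 'I_n) :
    ((i \in T) == (i \in S)) = ((inord 0 \in T) == (inord 0 \in S)).
  by rewrite -[in LHS](inord_val i) agree.
case: eqP agreeE => _ agreeE; [left | right]; apply/setP => i.
  exact/eqP/(agreeE i).
by have := agreeE i; rewrite inE; do 2 case: (_ \in _).
Qed.

(* The vectors [gamma (2 * j)] sum up to 0.                                    *)
Lemma colors_odd_card S c : c \in spin_structures dot -> colors S c ->
  odd #|S| = odd g.+1.
Proof.
move=> cP Sc.
have sum_even m : \sum_(j < m) c (gamma (2 * j)) = c (beta_pad m).
  elim: m => [|m IHm]; first by rewrite big_ord0 spin0.
  by rewrite big_ord_recr /= IHm spin_gamma_even // addrA addrr_F2 add0r.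
(* [beta_pad g.+1] is the default value 0, so the sum vanishes; by [sum_eqb_F2] it is also g + 1 +
   |S| mod 2. *)
have := sum_even g.+1; rewrite /= nth_default ?size_tuple // spin0 //.
pose f i := inord i \in S.
rewrite (eq_bigr (fun j : 'I_g.+1 => (f (2 * j)%N == f (2 * j).+1)%:R));
  last by move=> j _; apply: Sc; rewrite /n; have := ltn_ord j; lia.
have -> : #|S| = (\sum_(i < (2 * g.+1)%N) f i)%N.
  rewrite mulnS -sum1_card big_mkcond; apply: eq_bigr => i _.
  by rewrite /f inord_val; case: (i \in S).
rewrite sum_eqb_F2 natr_F2 oddD oddS; case: odd (odd g) => -[] // /eqP.
Qed.

(** * The action of the symmetric group *)

Section Action.

Context (iota : {morphism [set: 'S_n] >-> {perm H}}).
Hypothesis iotaP : is_iota dot alpha beta iota.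

(** The order is reversed because [s * t] applies [s] first. *)
Lemma spin_actM c s t :
  spin_act iota c (s * t)%g = spin_act iota (spin_act iota c t) s.
Proof. by apply/ffunP => x; rewrite !ffunE morphM ?inE // permM. Qed.

Lemma spin_act1 c : spin_act iota c 1%g = c.
Proof. by apply/ffunP => x; rewrite ffunE morph1 perm1. Qed.

Lemma spin_act_spin c s :
  c \in spin_structures dot -> spin_act iota c s \in spin_structures dot.
Proof.
move=> /spinP cP; apply/spinP => x y; rewrite !ffunE.
have : iota s \in Sp dot.
  by apply: (subsetP (iota_Sp iotaP)); rewrite mem_morphim ?inE.
by rewrite inE => /'forall_forallP/(_ x y)/andP[/eqP-> /eqP<-]; rewrite cP.
Qed.

Lemma iota_sigma i : (0 < g)%N -> (i < n.-1)%N ->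
  iota (sigma g i.+1) =1 transvection dot (gamma i).
Proof.
move=> g_gt0; rewrite /n /= ltnS => le_i.
have [odd_i|even_i] := boolP (odd i).
  have eq_i : i.+1 = (2 * i./2.+1)%N.
    by have := odd_double_half i; rewrite odd_i -muln2; lia.
  move=> x; rewrite eq_i (iota_even iotaP); last by lia.
  by rewrite /gamma odd_i.
have eq_i : i = (2 * i./2)%N.
  by have := odd_double_half i; rewrite (negPf even_i) -muln2; lia.
rewrite {}eq_i in le_i *; move: (i./2) le_i => j le_j x.
rewrite gamma_even.
have [->|j_gt0] := posnP j; first by rewrite (iota_first iotaP) /= add0r.
have [->|lt_jg] := eqVneq j g.
  rewrite (iota_last iotaP) /= -[in beta_pad g](prednK g_gt0) /=.
  by rewrite [beta`_g]nth_default ?size_tuple // addr0.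
rewrite (iota_odd iotaP); last by lia.
by case: j j_gt0 le_j lt_jg.
Qed.

(** If the letters i, i + 1 are on the same side, neither S nor c changes. Otherwise the exchange
    flips both letters, hence the labels of the two adjacent edges only, as does adding the form
    x.gamma_i to c. *)
Lemma colors_sigma S c i : (0 < g)%N -> (i < n.-1)%N ->
  c \in spin_structures dot -> colors S c ->
  colors (sigma g i.+1 @^-1: S) (spin_act iota c (sigma g i.+1)).
Proof.
move=> g_gt0 lt_i cP Sc j lt_j.
rewrite ffunE iota_sigma // spin_transvection // dot_gamma // !inE.
rewrite /sigma !permE /=.
have inord_eq a b : (a < n)%N -> (b < n)%N ->
    (inord a == inord b :> 'I_n) = (a == b).
  by move=> lt_a lt_b; rewrite -val_eqE /= !inordK.
have lt_i' : (i.+1 < n)%N by [].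
have lt_j' : (j.+1 < n)%N by [].
rewrite !inord_eq ?(ltnW lt_i') ?(ltnW lt_j') //.
rewrite (Sc i) // (Sc j) //.
have [->|neq_ij] := eqVneq j i.
  have -> : (i == i.+1) = false by lia.
  rewrite eqxx (_ : (i.+1 == i) = false); last by lia.
  by do 2 case: (_ \in S); apply/eqP.
have [->|neq_ij1] := eqVneq j i.+1.
  rewrite (_ : (i.+2 == i) = false); last by lia.
  rewrite (_ : (i.+2 == i.+1) = false); last by lia.
  by do 3 case: (_ \in S); apply/eqP.
rewrite eqSS (negPf neq_ij) /= (eq_sym i).
have [<-|neq_ji] := eqVneq j.+1 i.
  by do 3 case: (_ \in S); apply/eqP.
by rewrite mul0r addr0.
Qed.

Lemma colors_act S c (s : 'S_n) : (0 < g)%N ->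
  c \in spin_structures dot -> colors S c ->
  colors (s @^-1: S) (spin_act iota c s).
Proof.
move=> g_gt0.
elim/adjacent_tperm_ind: s S c => [|s t IHs IHt|i lt_i] S c cP Sc.
- rewrite spin_act1; suff -> : (1 : 'S_n)%g @^-1: S = S by [].
  by apply/setP => i; rewrite inE perm1.
- rewrite spin_actM; suff -> : (s * t)%g @^-1: S = s @^-1: (t @^-1: S).
    by apply: IHs; [exact: spin_act_spin | exact: IHt].
  by apply/setP => i; rewrite !inE permM.
- exact: colors_sigma.
Qed.

Lemma spin_orbit_refl c : c \in spin_orbit iota c.
Proof. by apply/imsetP; exists 1%g; rewrite ?inE // spin_act1. Qed.

Lemma spin_orbit_act c s :
  spin_orbit iota (spin_act iota c s) = spin_orbit iota c.
Proof.
apply/setP => c'; apply/imsetP/imsetP => -[t _ ->].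
  by exists (t * s)%g; rewrite ?inE // spin_actM.
by exists (t * s^-1)%g; rewrite ?inE // -spin_actM mulgKV.
Qed.

Lemma eq_card_spin_orbit S T c c' : (0 < g)%N ->
  c \in spin_structures dot -> c' \in spin_structures dot ->
  colors S c -> colors T c' -> #|S| = #|T| ->
  spin_orbit iota c = spin_orbit iota c'.
Proof.
move=> g_gt0 cP c'P Sc Tc' /exists_perm_preimset[s eqS].
rewrite -(spin_orbit_act c' s); congr (spin_orbit iota _).
apply: (colors_inj (S := S)) => //; first exact: spin_act_spin.
by rewrite eqS; apply: colors_act.
Qed.

(** Preimages under permutations keep the size; passing to the complement is the only ambiguity in
    S. *)
Lemma card_colors_orbit S T c c' : (0 < g)%N ->
  c \in spin_structures dot -> colors S c -> colors T c' ->
  c' \in spin_orbit iota c -> #|T| = #|S| \/ #|T| = (n - #|S|)%N.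
Proof.
move=> g_gt0 cP Sc Tc' /imsetP[s _ eqc']; rewrite {}eqc' in Tc'.
rewrite -(card_preimset S (@perm_inj _ s)).
have Ts := colors_act s g_gt0 cP Sc.
case: (colors_unique Ts Tc') => ->; first by left.
by right; rewrite [LHS]cardsCs setCK card_ord.
Qed.

End Action.

(** * The subsets belonging to the matrices M_m *)

(** The spin structure of M_m is 1 on the first 4m - 1 chain vectors and 0 on the others. So the
    first 4m letters lie on one side, and from letter 4m on the sides alternate. *)
Definition M_colors (m : nat) : {set 'I_n} :=
  [set i : 'I_n | (4 * m <= i)%N && ~~ odd i].

Lemma card_M_colors m d : n = (4 * (m + d))%N -> #|M_colors m| = (2 * d)%N.
Proof.
move=> eq_n.
have -> : #|M_colors m| =
    (\sum_(0 <= i < 4 * (m + d)) ((4 * m <= i) && ~~ odd i))%N.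
  rewrite -eq_n big_mkord -sum1_card big_mkcond; apply: eq_bigr => i _.
  by rewrite inE; case: ifP.
elim: d {eq_n} => [|d IHd].
  rewrite addn0 muln0 big_nat_cond big1 // => i.
  by rewrite andbT ltnNge => /negPf->.
have -> : (4 * (m + d.+1) = (4 * (m + d)).+4)%N by lia.
rewrite !big_nat_recr //= IHd; lia.
Qed.

Lemma colors_M_mx c m : (4 * m <= n)%N -> c \in spin_structures dot ->
  spin_mx alpha beta c = M_mx g m -> colors (M_colors m) c.
Proof.
rewrite /n => le_mn cP /matrixP eqM.
have le_mg : ((2 * m).-1 <= g)%N by lia.
have ca (j : 'I_g) : c alpha`_j = (j < (2 * m).-1)%N%:R.
  by have := eqM 0 j; rewrite mxE M_mxE //= => ->; case: ltnP.
have cb (j : nat) : (j <= g.+1)%N ->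
    c (beta_pad j) = ((j < 2 * m)%N && odd j)%:R.
  case: j => [|j] lt_j; first by rewrite spin0 // andbF.
  have [lt_jg|le_gj] := ltnP j g.
    have := eqM 1 (Ordinal lt_jg); rewrite mxE M_mxE //= => ->.
    have -> : (j < (2 * m).-1)%N = (j.+1 < 2 * m)%N by lia.
    by case: ltnP.
  (* Here j = g, and 4m <= 2g + 2 puts [beta_pad g.+1] beyond the block A_m. *)
  have -> : (j.+1 < 2 * m)%N = false by lia.
  by rewrite /= nth_default ?size_tuple // spin0.
move=> i lt_i; rewrite /n in lt_i.
rewrite !inE !inordK /n; try lia.
have -> : ((4 * m <= i) && ~~ odd i == ((4 * m <= i.+1) && ~~ odd i.+1))%N
  = (i < (4 * m).-1)%N by lia.
have [odd_i|even_i] := boolP (odd i).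
  have lt_ig : (i./2 < g)%N by lia.
  rewrite /gamma odd_i (ca (Ordinal lt_ig)) /=; congr _%:R; lia.
have -> : i = (2 * i./2)%N by lia.
rewrite spin_gamma_even // !cb; try lia.
rewrite -natrD natr_F2; congr _%:R; lia.
Qed.

End SpinStructures.

(** * Counting the orbits *)

Theorem theorem3p5 (k g : nat) (V : vectType 'F_2)
    (dot : {biscalar finvect_type V})
    (alpha beta : g.-tuple (finvect_type V))
    (iota : {morphism [set: 'S_((2 * g).+2)%N] >-> {perm finvect_type V}}) :
  (2 <= k)%N -> g = (2 * k - 1)%N ->
  symplectic_basis dot alpha beta ->
  is_iota dot alpha beta iota ->
  #|spin_orbits dot iota| = k.+1 /\
  exists C : 'I_k.+1 -> {set {ffun finvect_type V -> 'F_2}},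
    [/\ injective C,
        spin_orbits dot iota = [set C m | m : 'I_k.+1] &
        forall m : 'I_k.+1, exists c : {ffun finvect_type V -> 'F_2},
          unique (fun c' => c' \in spin_structures dot /\
                            spin_mx alpha beta c' = M_mx g m) c /\
          c \in C m].
Proof.
move=> k_gt1 eq_g sympl iotaP.
have g_gt0 : (0 < g)%N by lia.
have reprP (m : 'I_k.+1) :
    exists c, (c \in spin_structures dot) && (spin_mx alpha beta c == M_mx g m).
  have [c cP cM] := spin_mx_surj sympl (M_mx g m).
  by exists c; rewrite cP cM eqxx.
pose r m := xchoose (reprP m).
have rP m : r m \in spin_structures dot by case/andP: (xchooseP (reprP m)).
have rM m : spin_mx alpha beta (r m) = M_mx g m.
  by case/andP: (xchooseP (reprP m)) => _ /eqP.
have r_colors (m : 'I_k.+1) : colors alpha beta (M_colors g m) (r m).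
  by apply: (colors_M_mx sympl) => //; have := ltn_ord m; lia.
have card_r (m : 'I_k.+1) : #|M_colors g m| = (2 * (k - m))%N.
  by apply: card_M_colors; have := ltn_ord m; lia.
pose C m := spin_orbit iota (r m).
have C_inj : injective C.
  move=> m m' eqC; have := spin_orbit_refl iota (r m); rewrite -/(C m) eqC.
  have := ltn_ord m; have := ltn_ord m' => lt_m' lt_m rm.
  have := card_colors_orbit sympl iotaP g_gt0 (rP m') (r_colors m')
    (r_colors m) rm.
  (* Both sizes are at most 2k, half of the 4k letters, so the complementary case also forces them
     to be equal. *)
  by rewrite !card_r => card_eq; apply: val_inj; rewrite /=; lia.
have orbitsE : spin_orbits dot iota = [set C m | m : 'I_k.+1].
  apply/setP => X; apply/imsetP/imsetP => [[c cP ->]|[m _ ->]]; last first.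
    by exists (r m).
  (* Of S and its complement, one has at most 2k letters. *)
  have [S [Sc le_S]] : exists S, colors alpha beta S c /\ (#|S| <= 2 * k)%N.
    have [S Sc] := colors_exist alpha beta c.
    have [le_S|gt_S] := leqP #|S| (2 * k); first by exists S.
    exists (~: S); split; first exact: colors_setC.
    by have := cardsC S; rewrite card_ord; lia.
  have eq_S : #|S| = (2 * #|S|./2)%N.
    have := odd_double_half #|S|; rewrite (colors_odd_card sympl cP Sc).
    by rewrite -muln2 (_ : odd _ = false); lia.
  (* The index m solves |S| = 2(k - m), the size of [M_colors g m]. *)
  have lt_m : (k - #|S|./2 < k.+1)%N by lia.
  exists (Ordinal lt_m) => //.
  apply: (eq_card_spin_orbit sympl iotaP g_gt0 cP (rP _) Sc (r_colors _)).
  by rewrite card_r /= subKn //; lia.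
split; first by rewrite orbitsE card_imset ?card_ord.
exists C; split=> // m; exists (r m); split; last exact: spin_orbit_refl.
split=> // c [cP cM].
by apply: (spin_mx_inj sympl) => //; rewrite cM rM.
Qed.
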